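(* Let $f:\mathbb{R}^n\to\mathbb{R}$ be a self-concordant-like function with constant $M_f>0$ whose Hessian is positive definite at the iterates below, let $g$ be a proper, lower semicontinuous convex function on $\mathbb{R}^n$, and let $F:=f+g$. Let $\{\mathbf{x}^k\}_{k\ge0}$ be a sequence generated from $\mathbf{x}^0\in\mathrm{dom}(F)$ by the proximal-Newton scheme $\mathbf{x}^{k+1}:=\mathbf{x}^k+\alpha_k\mathbf{d}^k$, where $\mathbf{d}^k:=\mathbf{s}^k-\mathbf{x}^k$ and $$\mathbf{s}^k:=\arg\min_{\mathbf{x}}\Big\{f(\mathbf{x}^k)+\langle\nabla f(\mathbf{x}^k),\mathbf{x}-\mathbf{x}^k\rangle+\tfrac12\langle\nabla^2f(\mathbf{x}^k)(\mathbf{x}-\mathbf{x}^k),\mathbf{x}-\mathbf{x}^k\rangle+g(\mathbf{x})\Big\}.$$ Put $\lambda_k:=\langle\nabla^2f(\mathbf{x}^k)\mathbf{d}^k,\mathbf{d}^k\rangle^{1/2}$ and $r_k:=M_f\|\mathbf{d}^k\|_2$. If we choose the step-size $\alpha_k=r_k^{-1}\ln(1+r_k)$, then $$F(\mathbf{x}^{k+1})\le F(\mathbf{x}^k)-r_k^{-1}\lambda_k^2\left[\left(1+r_k^{-1}\right)\ln(1+r_k)-1\right].$$ Moreover, this step-size $\alpha_k$ is optimal (with respect to the worst-case performance).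
   Context: Self-concordant-like: a convex function $f\in\mathcal{C}^3(\mathbb{R}^n)$ is self-concordant-like with constant $M_f>0$ if for all $\mathbf{x}\in\mathrm{dom}(f)$ and $\mathbf{u}\in\mathbb{R}^n$ the function $\varphi(t):=f(\mathbf{x}+t\mathbf{u})$ satisfies $|\varphi'''(t)|\le M_f\,\varphi''(t)\,\|\mathbf{u}\|_2$ for $t\in\mathbb{R}$. The formulas are understood at iterations with $\mathbf{d}^k\ne0$, so that $r_k>0$. *)

(* Defs.v *)
From HB Require Import structures.
From mathcomp Require Import all_boot all_order all_algebra.
From mathcomp Require Import all_classical all_reals all_analysis.

Set Implicit Arguments.
Unset Strict Implicit.
Unset Printing Implicit Defensive.
Import Order.TTheory GRing.Theory Num.Theory.
Import numFieldNormedType.Exports.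

Local Open Scope classical_set_scope.
Local Open Scope ring_scope.

Definition dot {R : realType} {n : nat} (u v : 'cV[R]_n) : R :=
  \sum_(i < n) u i 0 * v i 0.

(* The library norm `|u| on matrices is the sup norm, hence this definition. *)
Definition norm2 {R : realType} {n : nat} (u : 'cV[R]_n) : R :=
  Num.sqrt (dot u u).

Definition gradient {R : realType} {n : nat} (f : 'cV[R]_n -> R)
    (x : 'cV[R]_n) : 'cV[R]_n :=
  \col_i 'D_(delta_mx i 0) f x.

Definition hessian {R : realType} {n : nat} (f : 'cV[R]_n -> R)
    (x : 'cV[R]_n) : 'M[R]_n :=
  \matrix_(i, j) 'D_(delta_mx i 0) ('D_(delta_mx j 0) f) x.

Definition posdef {R : realType} {n : nat} (A : 'M[R]_n) : Prop :=
  forall u : 'cV[R]_n, u != 0 -> 0 < dot (A *m u) u.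

(* Class C^k: f is (Frechet) differentiable and x |-> 'd f x v is C^(k-1) for
   every direction v; in finite dimension this says that 'd f is C^(k-1). *)
Fixpoint Ck {R : realType} {n : nat} (k : nat) (f : 'cV[R]_n -> R) : Prop :=
  if k is k'.+1 then
    (forall x, differentiable f x) /\ (forall v, Ck k' ('D_v f))
  else continuous f.

Definition self_concordant_like {R : realType} {n : nat}
    (f : 'cV[R]_n -> R) (M : R) : Prop :=
  [/\ 0 < M,
      @convex_function R 'cV[R]_n setT f,
      Ck 3 f &
      forall (x u : 'cV[R]_n) (t : R),
        let phi := fun t : R => f (x + t *: u) in
        `|phi^`(3)%classic t| <= M * phi^`(2)%classic t * norm2 u].

Definition proper_fun {R : realType} {T : Type} (g : T -> \bar R) : Prop :=
  (forall x, g x != -oo%E) /\ (exists x, (g x < +oo)%E).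

(* When t is 0 or 1 the product 0 * +oo is 0, so the inequality is trivial. *)
Definition ereal_convex {R : realType} {n : nat}
    (g : 'cV[R]_n -> \bar R) : Prop :=
  forall (x y : 'cV[R]_n) (t : R), 0 <= t <= 1 ->
    (g (t *: x + (1 - t) *: y)%R <= t%:E * g x + (1 - t)%:E * g y)%E.

Definition argmin {R : realType} {T : Type} (h : T -> \bar R) : set T :=
  [set s | forall y, (h s <= h y)%E].

Definition objective {R : realType} {n : nat} (f : 'cV[R]_n -> R)
    (g : 'cV[R]_n -> \bar R) (x : 'cV[R]_n) : \bar R :=
  ((f x)%:E + g x)%E.

Definition dom {R : realType} {T : Type} (h : T -> \bar R) : set T :=
  [set x | (h x < +oo)%E].

Definition newton_model {R : realType} {n : nat} (f : 'cV[R]_n -> R)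
    (g : 'cV[R]_n -> \bar R) (x y : 'cV[R]_n) : \bar R :=
  ((f x + dot (gradient f x) (y - x)
    + 2^-1 * dot (hessian f x *m (y - x)) (y - x))%:E + g y)%E.

Definition prox_newton_seq {R : realType} {n : nat} (f : 'cV[R]_n -> R)
    (g : 'cV[R]_n -> \bar R) (x s : nat -> 'cV[R]_n) (alpha : nat -> R) : Prop :=
  dom (objective f g) (x 0%N) /\
  forall k, argmin (newton_model f g (x k)) (s k) /\
            x k.+1 = x k + alpha k *: (s k - x k).

Definition local_norm {R : realType} {n : nat} (f : 'cV[R]_n -> R)
    (x d : 'cV[R]_n) : R :=
  Num.sqrt (dot (hessian f x *m d) d).

(* (f, g, x, s) is a problem in dimension n together with a point x and the
   corresponding s, whose data at x are the prescribed values lambda and r. *)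
Definition admissible {R : realType} {n : nat} (M lambda r : R)
    (f : 'cV[R]_n -> R) (g : 'cV[R]_n -> \bar R) (x s : 'cV[R]_n) : Prop :=
  [/\ self_concordant_like f M,
      [/\ proper_fun g, lower_semicontinuous g & ereal_convex g],
      dom (objective f g) x /\ posdef (hessian f x),
      argmin (newton_model f g x) s &
      local_norm f x (s - x) = lambda /\ M * norm2 (s - x) = r].

(* Worst-case performance of the step-size a: the supremum of
   F (x + a d) - F x, where d = s - x, over all the problems sharing the
   dimension n, the constant M and the quantities lambda and r on which the
   step-size may depend.  The smaller, the better. *)
Definition worst_case {R : realType} (n : nat) (M lambda r a : R) : \bar R :=
  ereal_sup [set v | exists (f : 'cV[R]_n -> R) (g : 'cV[R]_n -> \bar R)
      (x s : 'cV[R]_n), admissible M lambda r f g x s /\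
      v = (objective f g (x + a *: (s - x))%R - objective f g x)%E].

(* Main.v *)
Require Import Defs.
From HB Require Import structures.
From mathcomp Require Import all_boot all_order all_algebra.
From mathcomp Require Import all_classical all_reals all_analysis.
From mathcomp Require Import ring lra.

Set Implicit Arguments.
Unset Strict Implicit.
Unset Printing Implicit Defensive.
Import Order.TTheory GRing.Theory Num.Theory.
Import numFieldNormedType.Exports.

Local Open Scope classical_set_scope.
Local Open Scope ring_scope.

(* With [d = s - x] and [phi t = f (x + t d)], self-concordance makes
   [phi'' t * exp (- r t)] nonincreasing, so [phi'' t <= lambda^2 exp (r t)] and
   [phi t <= phi 0 + t phi' 0 + (lambda / r)^2 (exp (r t) - 1 - r t)].
   Optimality of [s] gives [g s - g x <= - phi' 0 - lambda^2].  By convexity of [g],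
   [F (x + t d) - F x] is at most
   [(lambda / r)^2 (exp (r t) - 1 - r t) - t lambda^2] for [0 <= t <= 1], and
   [t = ln (1 + r) / r] minimizes this profile.
   The profile is attained for every [t] by [f y = C * \sum_i exp (M y_i)] with
   [C = (lambda / r)^2], [x = 0], [s = (r / M) e_i] and a linear [g] that makes
   [s] the prox-Newton point; hence no step-size has a better worst case. *)

(** * Comparison of functions of one variable through their derivatives *)

Section RealFunctions.
Variable R : realType.

(** The mean value theorem on [[0, t]]. Applied to differences of functions, it takes the place of
    integration below. *)
Lemma derive_le0_le (h h' : R -> R) (t : R) :
  (forall u : R, is_derive u 1 h (h' u)) -> (forall u, 0 <= u -> h' u <= 0) ->
  0 <= t -> h t <= h 0.
Proof.
move=> hd h'_le0 t0.
have [|c c0t E] := @MVT_segment R h h' 0 t t0 (fun u _ => hd u).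
  apply: continuous_subspaceT => u.
  by apply/differentiable_continuous/derivable1_diffP; apply: ex_derive.
rewrite -subr_le0 E mulr_le0_ge0 ?subr0// h'_le0//.
by move: c0t; rewrite in_itv/= => /andP[].
Qed.

Lemma is_derive_mull (c t : R) : is_derive t 1 (fun u => c * u) c.
Proof.
by apply: (is_derive_eq (f := c \*: id)) => //; rewrite scaler1.
Qed.

Lemma is_derive_expR_lin (r t : R) :
  is_derive t 1 (fun u => expR (r * u)) (r * expR (r * t)).
Proof.
have := @is_derive1_comp R expR (fun u => r * u) t _ _
  (is_derive_expR _) (is_derive_mull r t).
by rewrite mulrC.
Qed.

(** A Gronwall estimate on [p2], followed by two integrations from [0]. *)
Lemma self_concordant_like_upper (p0 p1 p2 p3 : R -> R) (r t : R) :
  (forall u : R, is_derive u 1 p0 (p1 u)) ->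
  (forall u : R, is_derive u 1 p1 (p2 u)) ->
  (forall u : R, is_derive u 1 p2 (p3 u)) -> (forall u, p3 u <= r * p2 u) ->
  0 < r -> 0 <= t ->
  p0 t <= p0 0 + t * p1 0 + p2 0 / r ^+ 2 * (expR (r * t) - 1 - r * t).
Proof.
move=> d0 d1 d2 p3_le r0.
have rn0 : r != 0 by rewrite gt_eqF.
have dE c u := is_derive_expR_lin c u.
have le2 u : 0 <= u -> p2 u <= p2 0 * expR (r * u).
  move=> u0.
  (* The integrating factor turns [p3 - r * p2 <= 0] into the monotonicity of a product. *)
  have : p2 u * expR (- r * u) <= p2 0 * expR (- r * 0).
    apply: (@derive_le0_le (fun u => p2 u * expR (- r * u))
      (fun u => p2 u * (- r * expR (- r * u)) + expR (- r * u) * p3 u)) => //.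
      by move=> v; apply: is_deriveM.
    move=> v _.
    rewrite (_ : _ + _ = expR (- r * v) * (p3 v - r * p2 v)); last by ring.
    by rewrite mulr_ge0_le0 ?expR_ge0// subr_le0.
  by rewrite mulr0 expR0 mulr1 mulNr expRN ler_pdivrMr ?expR_gt0.
have le1 u : 0 <= u -> p1 u <= p1 0 + p2 0 / r * (expR (r * u) - 1).
  move=> u0.
  have : p1 u - p2 0 / r * expR (r * u) <= p1 0 - p2 0 / r * expR (r * 0).
    apply: (@derive_le0_le (fun u => p1 u - p2 0 / r * expR (r * u))
      (fun u => p2 u - p2 0 / r * (r * expR (r * u)))) => //.
    by move=> v v0; rewrite mulrA divfK// subr_le0 le2.
  by rewrite mulr0 expR0; lra.
move=> t0.
have dt (v : R) : is_derive v 1 (fun u => u * p1 0) (p1 0).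
  by under eq_fun do rewrite mulrC; exact: is_derive_mull.
have dr v := is_derive_mull r v.
(* The subtracted function is a primitive of the bound in [le1]. *)
have : p0 t - (t * p1 0 + p2 0 / r ^+ 2 * (expR (r * t) - r * t))
    <= p0 0 - (0 * p1 0 + p2 0 / r ^+ 2 * (expR (r * 0) - r * 0)).
  apply: (@derive_le0_le
    (fun u => p0 u - (u * p1 0 + p2 0 / r ^+ 2 * (expR (r * u) - r * u)))
    (fun u => p1 u - (p1 0 + p2 0 / r ^+ 2 * (r * expR (r * u) - r)))) => //.
  move=> v v0; have := le1 _ v0.
  rewrite (_ : p2 0 / r ^+ 2 * _ = p2 0 / r * (expR (r * v) - 1)); last first.
    by field.
  lra.
by rewrite !mulr0 expR0 mul0r; lra.
Qed.

End RealFunctions.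

(** * Restriction to lines, gradient and Hessian *)

Section DirectionalDerivatives.
Variables (R : realType) (n : nat).
Implicit Types (f : 'cV[R]_n -> R) (x u v : 'cV[R]_n) (t : R).

Lemma is_derive_line f x u t : derivable f (x + t *: u) u ->
  is_derive t 1 (fun h => f (x + h *: u)) ('D_u f (x + t *: u)).
Proof.
rewrite /derivable => df.
have E : (fun h : R => h^-1 *: (((fun k => f (x + k *: u)) \o shift t) (h *: 1)
      - f (x + t *: u))) =
    (fun h : R => h^-1 *: ((f \o shift (x + t *: u)) (h *: u)
      - f (x + t *: u))).
  apply/funext => h /=; congr (_ *: (f _ - _)).
  by rewrite [_%:A]mulr1 scalerDl addrCA.
by apply: DeriveDef; rewrite /derivable /derive E.
Qed.

Lemma derive_gradient f x u :
  differentiable f x -> 'D_u f x = dot (gradient f x) u.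
Proof.
move=> df; rewrite deriveE// {1}[u]matrix_sum_delta linear_sum /dot/=.
apply: eq_bigr => i _; rewrite big_ord1 linearZ/= mxE deriveE// mulrC//.
Qed.

Lemma CkW k f : Ck k.+1 f -> Ck k f.
Proof.
elim: k f => [|k IHk] f [df dkf].
  by move=> y; exact: differentiable_continuous.
by split=> // v; exact/IHk/dkf.
Qed.

(** Expanding the inner ['D_u f] over coordinates leaves directional derivatives of the partials,
    which are again gradients; exchanging the two sums then matches the index order of [hessian]. *)
Lemma derive_hessian f x u : Ck 2 f ->
  'D_u ('D_u f) x = dot (hessian f x *m u) u.
Proof.
move=> [df d2f].
have -> : 'D_u f = \sum_(j < n) (u j 0 \*: 'D_(delta_mx j 0) f).
  apply/funext => y; rewrite derive_gradient// /dot fct_sumE.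
  by apply: eq_bigr => j _; rewrite mxE mulrC.
have dj j : differentiable ('D_(delta_mx j 0) f) x.
  by have [+ _] := d2f (delta_mx j 0).
rewrite derive_sum => [|j]; last exact/derivableZ/diff_derivable.
rewrite (eq_bigr (fun j =>
  u j 0 * dot (gradient ('D_(delta_mx j 0) f) x) u)); last first.
  by move=> j _; rewrite deriveZ ?derive_gradient//; exact: diff_derivable.
rewrite /dot.
under [RHS]eq_bigr do rewrite mxE mulr_suml.
rewrite exchange_big/=; apply: eq_bigr => j _.
rewrite mulr_sumr; apply: eq_bigr => i _.
by rewrite !mxE mulrCA mulrA mulrAC.
Qed.

Lemma derive1_line f x u : (forall y, differentiable f y) ->
  (fun t : R => f (x + t *: u))^`()%classic = fun t => 'D_u f (x + t *: u).
Proof.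
move=> df; apply/funext => t; rewrite derive1E.
by case: (@is_derive_line f x u t (diff_derivable (df _))).
Qed.

Lemma derive1n_line f x u k : Ck k f ->
  (fun t : R => f (x + t *: u))^`(k)%classic =
  fun t => iter k (fun h => 'D_u h) f (x + t *: u).
Proof.
elim: k f => [//|k IHk] f [df dkf].
rewrite derive1Sn derive1_line// (IHk ('D_u f)); last exact: dkf.
by apply/funext => t; rewrite iterSr.
Qed.

End DirectionalDerivatives.

(** * Dot product and Euclidean norm *)

Section InnerProduct.
Variables (R : realType) (n : nat).
Implicit Types (u v c : 'cV[R]_n) (i : 'I_n).

Lemma dotZr u v (c : R) : dot u (c *: v) = c * dot u v.
Proof.
by rewrite /dot mulr_sumr; apply: eq_bigr => i _; rewrite mxE mulrCA.
Qed.

Lemma dotZl u v (c : R) : dot (c *: u) v = c * dot u v.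
Proof.
by rewrite /dot mulr_sumr; apply: eq_bigr => i _; rewrite mxE mulrA.
Qed.

Lemma dotDr u v c : dot c (u + v) = dot c u + dot c v.
Proof.
by rewrite /dot -big_split/=; apply: eq_bigr => i _; rewrite mxE mulrDr.
Qed.

Lemma dotC u v : dot u v = dot v u.
Proof. by rewrite /dot; apply: eq_bigr => i _; rewrite mulrC. Qed.

Lemma dotDl u v c : dot (u + v) c = dot u c + dot v c.
Proof. by rewrite dotC dotDr !(dotC c). Qed.

Lemma dotNl u v : dot (- u) v = - dot u v.
Proof. by rewrite -scaleN1r dotZl mulN1r. Qed.

Lemma lower_semicontinuous_dot c :
  lower_semicontinuous (fun y => (dot c y)%:E).
Proof.
move=> x a; rewrite lte_fin => ax.
have dc : continuous (dot c).
  move=> y; apply: differentiable_continuous.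
  rewrite (_ : dot c =
      \sum_(i < n) (c i 0 \*: (fun y : 'cV[R]_n => y i 0 : R))).
    by apply: differentiable_sum => i;
      apply/differentiableZ/differentiable_coord.
  by apply/funext => z; rewrite fct_sumE.
exists [set y | a < dot c y] => //=.
by have := @cvgr_gt _ _ _ _ _ _ (dc x) a ax; apply.
Qed.

Lemma normr_coord_norm2 u i : `|u i 0| <= norm2 u.
Proof.
rewrite /norm2 -sqrtr_sqr ler_wsqrtr// expr2 /dot (bigD1 i)//= lerDl.
by rewrite sumr_ge0// => j _; rewrite -expr2 sqr_ge0.
Qed.

Lemma norm2_gt0 u : u != 0 -> 0 < norm2 u.
Proof.
apply: contra_neqT; rewrite -leNgt => u0; apply/matrixP => i j.
rewrite ord1 mxE; apply/normr0_eq0/le_anti.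
by rewrite normr_ge0 (le_trans (normr_coord_norm2 u i)).
Qed.

Lemma norm2_delta i (c : R) : norm2 (c *: delta_mx i 0 : 'cV[R]_n) = `|c|.
Proof.
rewrite /norm2 dotZl dotZr mulrA -expr2 /dot (bigD1 i)//= big1 ?addr0.
  by rewrite !mxE !eqxx !mulr1 sqrtr_sqr.
by move=> j /negbTE ji; rewrite !mxE ji mul0r.
Qed.

End InnerProduct.

(** * Decrease of the objective along one proximal-Newton step *)

Section Descent.
Variables (R : realType) (n : nat).
Implicit Types (f : 'cV[R]_n -> R) (g : 'cV[R]_n -> \bar R) (x s u : 'cV[R]_n).

(** [Num.sqrt] vanishes on negative arguments, so positive definiteness is what lets the square undo
    the root. *)
Lemma local_norm_sqr f x u : posdef (hessian f x) ->
  local_norm f x u ^+ 2 = dot (hessian f x *m u) u.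
Proof.
move=> H; rewrite sqr_sqrtr//; have [->|/H/ltW//] := eqVneq u 0.
by rewrite mulmx0 /dot sumr_ge0// => i _; rewrite mxE mul0r.
Qed.

Lemma newton_step_smooth_upper f M x u (t : R) : self_concordant_like f M ->
  posdef (hessian f x) -> u != 0 -> 0 <= t ->
  let r := M * norm2 u in
  f (x + t *: u) <= f x + t * dot (gradient f x) u
    + local_norm f x u ^+ 2 / r ^+ 2 * (expR (r * t) - 1 - r * t).
Proof.
move=> [M0 _ C3 sc] H u0 t0 /=; set r := M * _.
have r0 : 0 < r by rewrite mulr_gt0// norm2_gt0.
have [df d2f] := C3; have [ddf d3f] := d2f u; have [dddf _] := d3f u.
have C2 := CkW C3.
have D0 (h : R) : is_derive h 1 (fun h => f (x + h *: u)) ('D_u f (x + h *: u)).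
  by apply: is_derive_line; exact: diff_derivable.
have D1 (h : R) : is_derive h 1 (fun h => 'D_u f (x + h *: u))
    ('D_u ('D_u f) (x + h *: u)).
  by apply: is_derive_line; exact: diff_derivable.
have D2 (h : R) : is_derive h 1 (fun h => 'D_u ('D_u f) (x + h *: u))
    ('D_u ('D_u ('D_u f)) (x + h *: u)).
  by apply: is_derive_line; exact: diff_derivable.
have D3 (h : R) : 'D_u ('D_u ('D_u f)) (x + h *: u) <=
    r * 'D_u ('D_u f) (x + h *: u).
  have := sc x u h; cbv zeta.
  rewrite (derive1n_line x u C3) (derive1n_line x u C2) /=.
  by rewrite mulrAC; apply: le_trans; exact: ler_norm.
have := self_concordant_like_upper D0 D1 D2 D3 r0 t0.
by rewrite scale0r addr0 local_norm_sqr// -derive_hessian// -derive_gradient.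
Qed.

(** The model at [s] is compared with the model at [t *: x + (1 - t) *: s]. Dividing by [t] and
    letting [t] tend to [0] gives the Hessian term with coefficient 1; comparison with [x] alone
    would give only 1/2. *)
Lemma prox_newton_optimality f g x s : proper_fun g -> ereal_convex g ->
  argmin (newton_model f g x) s -> dom g x ->
  let d := s - x in
  exists gx gs : R, [/\ g x = gx%:E, g s = gs%:E &
    gs + dot (gradient f x) d + dot (hessian f x *m d) d <= gx].
Proof.
move=> [gNy _] gc smin xdom /=; set d := s - x.
have /fineK gxE : g x \is a fin_num by rewrite fin_numE gNy/= lt_eqF.
have := smin x; rewrite /newton_model -gxE -EFinD => hsx.
(* The model at [x] is finite and bounds the one at [s], so [g s] cannot be [+oo]. *)
have /fineK gsE : g s \is a fin_num.
  rewrite fin_numE gNy/=; apply/negP => /eqP gs.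
  by move: hsx; rewrite gs.
exists (fine (g x)), (fine (g s)); split => //.
set a := fine (g x); set b := fine (g s).
set A := dot (gradient f x) d; set B := dot _ d.
have step (t : R) : 0 < t <= 1 -> b + A + (1 - t / 2) * B <= a.
  move=> /andP[t0 t1].
  have yx : t *: x + (1 - t) *: s - x = (1 - t) *: d.
    by apply/matrixP => i j; rewrite !mxE; ring.
  have : (g s + (A + 2^-1 * B)%:E <=
      (t * a + (1 - t) * b + (1 - t) * A + 2^-1 * (1 - t) ^+ 2 * B)%:E)%E.
    have := smin (t *: x + (1 - t) *: s); rewrite /newton_model.
    have := gc x s t; rewrite ltW//= => /(_ t1).
    rewrite -gxE -gsE -!EFinM -!EFinD yx -/a -/b -/d -/A -/B => gy.
    move=> /le_trans/(_ (leeD2l _ gy)); rewrite -!EFinD !lee_fin.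
    by rewrite -scalemxAr dotZl !dotZr -/A -/B; lra.
  by rewrite -gsE -EFinD lee_fin -/b; nra.
apply/ler_addgt0Pr => e e0.
(* The minimum keeps [t] admissible, the [+ 1] avoids a zero denominator, and [t * B <= e] absorbs
   the error [t / 2 * B]. *)
pose t := Num.min 1 (e / (`|B| + 1)).
have B1 : 0 < `|B| + 1 by rewrite ltr_wpDl.
have t0 : 0 < t by rewrite lt_min ltr01 divr_gt0.
have := step t; rewrite t0 ge_min lexx/= => /(_ isT).
have : t * B <= e.
  apply: le_trans (ler_wpM2l (ltW t0) (ler_norm B)) _.
  have : t * (`|B| + 1) <= e by rewrite -ler_pdivlMr// ge_min lexx orbT.
  by lra.
lra.
Qed.

(** The smooth upper bound is added to the convexity of [g] between [x] and [s]; optimality of [s]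
    cancels the slope term, and [expR (r * t) = 1 + r] at the chosen [t]. *)
Lemma prox_newton_decrease f g M x s : self_concordant_like f M ->
  proper_fun g -> ereal_convex g -> posdef (hessian f x) ->
  argmin (newton_model f g x) s -> dom g x -> s != x ->
  let r := M * norm2 (s - x) in
  let lambda := local_norm f x (s - x) in
  (objective f g (x + (r^-1 * ln (1 + r)) *: (s - x)) <= objective f g x
     - (r^-1 * lambda ^+ 2 * ((1 + r^-1) * ln (1 + r) - 1))%:E)%E.
Proof.
move=> fM gp gc H smin xdom; rewrite -subr_eq0 => d0 /=.
set r := M * _; set lambda := local_norm _ _ _.
have [M0 _ _ _] := fM.
have r0 : 0 < r by rewrite mulr_gt0// norm2_gt0.
set t := r^-1 * _.
have rt : r * t = ln (1 + r) by rewrite mulVKf// gt_eqF.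
have t0 : 0 <= t by rewrite mulr_ge0 ?invr_ge0 ?ln_ge0 ?lerDl// ltW.
(* [ln (1 + r) <= r] puts the step in [[0, 1]], where convexity of [g] applies. *)
have t1 : t <= 1 by rewrite /t mulrC ler_pdivrMr// mul1r le_ln1Dx//; lra.
have [gx [gs [gxE gsE opt]]] := prox_newton_optimality gp gc smin xdom.
have := newton_step_smooth_upper fM H d0 t0.
rewrite /= -/r -/lambda rt lnK ?posrE; last lra.
have /(gc s x) : 0 <= t <= 1 by rewrite t0.
have -> : t *: s + (1 - t) *: x = x + t *: (s - x).
  by rewrite scalerBl scale1r scalerBr addrCA.
rewrite gxE gsE -!EFinM -EFinD /objective => gle fle.
apply: le_trans (leeD2l _ gle) _.
rewrite gxE -!EFinD lee_fin.
have -> : r^-1 * lambda ^+ 2 * ((1 + r^-1) * ln (1 + r) - 1) =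
  t * lambda ^+ 2 - lambda ^+ 2 / r ^+ 2 * (1 + r - 1 - ln (1 + r)).
  by rewrite /t; field; rewrite gt_eqF.
move: opt; rewrite -local_norm_sqr// -/lambda => opt.
have := ler_wpM2l t0 opt; lra.
Qed.

End Descent.

(** * Sums of exponentials, the extremal smooth functions *)

Section ExponentialSum.
Variables (R : realType) (n : nat).
Implicit Types (a : 'I_n -> R) (x u v : 'cV[R]_n) (M C : R).

(** The weights depend on [i] so that the family is closed under directional derivatives. *)
Definition expsum M a x : R := \sum_(i < n) a i * expR (M * x i 0).

Lemma differentiable_expsum M a x : differentiable (expsum M a) x.
Proof.
pose h i (y : 'cV[R]_n) : R := a i * expR (M * y i 0).
rewrite (_ : expsum M a = \sum_(i < n) h i).
  apply: differentiable_sum => i.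
  apply: (@differentiable_comp _ _ _ _ (fun y : 'cV[R]_n => y i 0 : R)
    (fun t : R => a i * expR (M * t))); first exact: differentiable_coord.
  apply/derivable1_diffP.
  by apply: (@derivableZ _ _ _ (fun t : R => expR (M * t)));
    case: (is_derive_expR_lin M (x i 0)).
by apply/funext => y; rewrite fct_sumE.
Qed.

Lemma derive_expsumE M a x v :
  'D_v (expsum M a) x = expsum M (fun i => a i * (M * v i 0)) x.
Proof.
(* The derivative at [0] along the line is computed in two ways and identified by uniqueness. *)
have D := @is_derive_line _ _ (expsum M a) x v 0
  (diff_derivable (differentiable_expsum _ _ _)).
have : is_derive (0 : R) 1 (fun h => expsum M a (x + h *: v))
    (expsum M (fun i => a i * (M * v i 0)) x).
  rewrite (_ : (fun _ => _) = \sum_(i < n)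
      ((a i * expR (M * x i 0)) \*: (fun h => expR ((M * v i 0) * h)))).
    rewrite /expsum; apply: is_derive_sum => i.
    have := is_deriveZ (a i * expR (M * x i 0))
      (is_derive_expR_lin (M * v i 0) 0).
    rewrite mulr0 expR0 mulr1 => D'; apply: (is_derive_eq D').
    by rewrite [LHS]mulrAC.
  apply/funext => h; rewrite fct_sumE; apply: eq_bigr => i _.
  transitivity (a i * expR (M * x i 0) * expR (M * v i 0 * h)) => [|//].
  by rewrite -mulrA -expRD !mxE; congr (_ * expR _); ring.
by case: D => _; rewrite scale0r addr0 => <- [_ <-].
Qed.

Lemma derive_expsum M a v :
  'D_v (expsum M a) = expsum M (fun i => a i * (M * v i 0)).
Proof. by apply/funext => x; exact: derive_expsumE. Qed.

Lemma Ck_expsum k M a : Ck k (expsum M a).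
Proof.
elim: k a => [|k IHk] a /=.
  by move=> x; exact/differentiable_continuous/differentiable_expsum.
split=> [x|v]; first exact: differentiable_expsum.
by rewrite derive_expsum; exact: IHk.
Qed.

Lemma convex_expsum M a : (forall i, 0 <= a i) ->
  @convex_function R 'cV[R]_n setT (expsum M a).
Proof.
move=> a0 t x y _ _; rewrite convRE /expsum !mulr_sumr -big_split/=.
apply: ler_sum => i _; rewrite !mxE.
have := ler_wpM2l (a0 i) (convex_expR t (M * x i 0) (M * y i 0)).
rewrite !convRE mulrDr ![a i * (_ * expR _)]mulrCA.
apply: le_trans; rewrite le_eqVlt; apply/predU1P; left.
by congr (_ * expR _); ring.
Qed.

(** In direction [u], the third derivative of each term is [M * u i 0] times its nonnegative second
    derivative, and a coordinate is at most the norm. *)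
Lemma expsum_self_concordant_like M C : 0 < M -> 0 <= C ->
  self_concordant_like (expsum M (fun=> C)) M.
Proof.
move=> M0 C0; split => //; [exact: convex_expsum|exact: Ck_expsum|].
move=> x u t; cbv zeta.
rewrite (derive1n_line x u (Ck_expsum 3 _ _))
  (derive1n_line x u (Ck_expsum 2 _ _)).
rewrite /= !derive_expsum !derive_expsumE /expsum mulrAC mulr_sumr.
apply: le_trans (ler_norm_sum _ _ _) _; apply: ler_sum => i _.
set e := expR _; set w := u i 0.
have -> : C * (M * w) * (M * w) * (M * w) * e =
  M * w * (C * (M * w) * (M * w) * e) by ring.
have q0 : 0 <= C * (M * w) * (M * w) * e.
  by rewrite mulr_ge0 ?expR_ge0// -mulrA mulr_ge0// -expr2 sqr_ge0.
rewrite normrM (ger0_norm q0) ler_wpM2r// normrM (gtr0_norm M0).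
by apply: ler_wpM2l; [exact: ltW|exact: normr_coord_norm2].
Qed.

Lemma gradient_expsum0 M C : gradient (expsum M (fun=> C)) 0 = const_mx (C * M).
Proof.
apply/matrixP => i j; rewrite !mxE derive_expsumE /expsum (bigD1 i)//= big1.
  by rewrite !mxE !eqxx mulr0 expR0 !mulr1 addr0.
by move=> k /negbTE ki; rewrite !mxE ki !mulr0 mul0r.
Qed.

Lemma hessian_expsum0 M C :
  hessian (expsum M (fun=> C)) 0 = (C * M ^+ 2)%:M.
Proof.
apply/matrixP => i j; rewrite !mxE derive_expsum derive_expsumE.
rewrite /expsum (bigD1 i)//= big1.
  by rewrite !mxE !eqxx mulr0 expR0 !mulr1 addr0 andbT; case: eqP => _ /=;
     rewrite ?mulr1n ?mulr0n; ring.
by move=> k /negbTE ki; rewrite !mxE ki !mulr0 mul0r.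
Qed.

Lemma expsum_axis M C i (t : R) :
  expsum M (fun=> C) (t *: delta_mx i 0) =
  expsum M (fun=> C) 0 + C * (expR (M * t) - 1).
Proof.
rewrite /expsum [in LHS](bigD1 i)//= [in RHS](bigD1 i)//=.
rewrite !mxE !eqxx mulr0 expR0 mulr1.
rewrite (eq_bigr (fun j => C * expR (M * (0 : 'cV[R]_n) j 0))).
  by rewrite mulrBr mulr1; ring.
by move=> j /negbTE ji; rewrite !mxE ji !mulr0.
Qed.

End ExponentialSum.

(** * Lower bound on the worst case from an extremal problem *)

Section WorstCase.
Variables (R : realType) (n : nat).

(** An explicit admissible problem attains this value. The index [i] selects the axis of its step
    and ensures a positive dimension. *)
Lemma worst_case_ge (i : 'I_n) (M lambda r a : R) :
  0 < M -> 0 < lambda -> 0 < r ->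
  ((lambda ^+ 2 / r ^+ 2 * (expR (r * a) - 1 - r * a) - a * lambda ^+ 2)%:E
   <= worst_case n M lambda r a)%E.
Proof.
move=> M0 l0 r0; have [Mn rn] := (lt0r_neq0 M0, lt0r_neq0 r0).
(* The Hessian at [0] is [C * M ^+ 2] times the identity and [norm2 d = r / M], so local norm
   [lambda] requires [C * r ^+ 2 = lambda ^+ 2]. *)
pose C := lambda ^+ 2 / r ^+ 2.
have C0 : 0 < C by rewrite divr_gt0// exprn_gt0.
pose f := expsum M (fun _ : 'I_n => C).
pose d : 'cV[R]_n := (r / M) *: delta_mx i 0.
pose m : 'cV[R]_n := const_mx (C * M).
pose K := C * M ^+ 2.
have K0 : 0 < K by rewrite mulr_gt0// exprn_gt0.
have gradE : gradient f 0 = m by exact: gradient_expsum0.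
have hessE u : hessian f 0 *m u = K *: u.
  by rewrite hessian_expsum0 mul_scalar_mx.
have dd : dot d d = (r / M) ^+ 2.
  rewrite dotZl dotZr /dot (bigD1 i)//= big1 ?addr0 ?mxE ?eqxx ?mulr1 ?expr2//.
  by move=> j /negbTE ji; rewrite !mxE ji mul0r.
have md : dot m d = C * r.
  rewrite dotZr /dot (bigD1 i)//= big1 ?addr0 ?mxE ?eqxx ?mulr1.
    by rewrite mulrCA divfK.
  by move=> j /negbTE ji; rewrite !mxE ji mulr0.
have Kdd : K * dot d d = lambda ^+ 2.
  by rewrite dd /K /C; field; rewrite Mn rn.
(* This slope makes the gradient of the model at [y] equal to [K *: (y - d)], which vanishes at
   [d]. *)
pose g y := (dot (- (m + K *: d)) y)%:E.
apply: ereal_sup_ubound; exists f, g, 0, d; split.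
  split.
  - by apply: expsum_self_concordant_like => //; exact: ltW.
  - split; [|exact: lower_semicontinuous_dot|].
      by split=> [//|]; exists 0; rewrite ltry.
    move=> y z t _; rewrite /g -!EFinM -EFinD lee_fin dotDr !dotZr lexx//.
  - split; first by rewrite /dom/= /objective ltry.
    move=> u /norm2_gt0; rewrite sqrtr_gt0 => u0.
    by rewrite hessE dotZl mulr_gt0.
  - move=> y; rewrite /newton_model !subr0 gradE !hessE /g -!EFinD lee_fin.
    (* The model at [y] exceeds the model at [d] by half this quantity. *)
    have : 0 <= K * dot (y - d) (y - d).
      apply: mulr_ge0; first exact: ltW.
      by rewrite /dot sumr_ge0// => j _; rewrite -expr2 sqr_ge0.
    have -> : dot (y - d) (y - d) = dot y y - 2 * dot d y + dot d d.
      by rewrite dotDl !dotDr (dotC y (- d)) !dotNl (dotC d (- d)) dotNl; ring.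
    by rewrite !dotNl !dotDl !(dotZl _ _ K); lra.
  - rewrite subr0; split.
      by rewrite /local_norm hessE dotZl Kdd sqrtr_sqr gtr0_norm.
    by rewrite norm2_delta gtr0_norm ?divr_gt0// mulrCA divff// mulr1.
(* Along [a *: d], [f] changes by [C * (expR (r * a) - 1)] and [g] by
   [- a * (C * r + lambda ^+ 2)]. *)
rewrite subr0 add0r /objective /g -!EFinD; congr _%:E.
rewrite (dotZr _ d a) dotNl dotDl (dotZl _ _ K) md Kdd.
rewrite (_ : dot _ 0 = 0); last by rewrite -(scale0r d) (dotZr _ d 0) mul0r.
rewrite /f {1}/d scalerA expsum_axis.
rewrite (_ : M * (a * (r / M)) = r * a); last by field.
rewrite -/C; have -> : lambda ^+ 2 = C * r ^+ 2 by rewrite divfK// expf_neq0.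
by ring.
Qed.

End WorstCase.

(** * Optimality of the logarithmic step-size *)

Section Optimality.
Variables (R : realType) (n : nat).
Implicit Types M lambda r a : R.

(** The decrease estimate depends only on [lambda] and [r], hence is uniform over the admissible
    problems. *)
Lemma worst_case_le M lambda r : 0 < r ->
  (worst_case n M lambda r (r^-1 * ln (1 + r)) <=
   (- (r^-1 * lambda ^+ 2 * ((1 + r^-1) * ln (1 + r) - 1)))%:E)%E.
Proof.
move=> r0; apply: ge_ereal_sup => _ [f [g [x [s [adm ->]]]]].
have [fM [gp _ gc] [Fdom H] smin [lE rE]] := adm.
have sx : s != x.
  apply: contraTneq r0 => sx; rewrite -rE sx subrr /norm2 /dot big1 ?sqrtr0.
    by rewrite mulr0 ltxx.
  by move=> i _; rewrite mxE mul0r.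
have gdom : dom g x.
  move: Fdom; rewrite /dom/= /objective.
  by case: (g x) => [y| |]; rewrite ?ltry.
have := prox_newton_decrease fM gp gc H smin gdom sx.
rewrite /= lE rE => le.
(* Finiteness allows this term to cross the inequality in the extended reals. *)
have : objective f g x \is a fin_num.
  rewrite fin_numE (lt_eqF Fdom) andbT /objective.
  by have := gp.1 x; case: (g x).
by move=> ?; rewrite leeBlDl.
Qed.

(* The lower model [expR z >= 1 + z] at [z = r * a - ln (1 + r)] is tangent at
   the minimizer. *)
Lemma step_profile_ge lambda r a : 0 < r ->
  - (r^-1 * lambda ^+ 2 * ((1 + r^-1) * ln (1 + r) - 1)) <=
  lambda ^+ 2 / r ^+ 2 * (expR (r * a) - 1 - r * a) - a * lambda ^+ 2.
Proof.
move=> r0; have rn : r != 0 by rewrite gt_eqF.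
have e : (1 + r) * (1 + (r * a - ln (1 + r))) <= expR (r * a).
  rewrite -[in leRHS](subrK (ln (1 + r)) (r * a)) expRD lnK ?posrE; last lra.
  by rewrite mulrC ler_wpM2r ?expR_ge1Dx//; lra.
rewrite -subr_ge0 (_ : _ - _ = lambda ^+ 2 / r ^+ 2 *
  (expR (r * a) - (1 + r) * (1 + (r * a - ln (1 + r))))); last by field.
by rewrite mulr_ge0 ?subr_ge0// divr_ge0// sqr_ge0.
Qed.

(** The upper bound at the logarithmic step is the minimum of the profile, whose value at [a] bounds
    the worst case of [a] from below. *)
Lemma worst_case_optimal (i : 'I_n) M lambda r a :
  0 < M -> 0 < lambda -> 0 < r ->
  (worst_case n M lambda r (r^-1 * ln (1 + r)) <= worst_case n M lambda r a)%E.
Proof.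
move=> M0 l0 r0; apply: le_trans (worst_case_le M lambda r0) _.
apply: le_trans (worst_case_ge i a M0 l0 r0).
by rewrite lee_fin step_profile_ge.
Qed.

End Optimality.

Theorem lemma3 (R : realType) (n : nat) (f : 'cV[R]_n -> R) (M : R)
    (g : 'cV[R]_n -> \bar R) (x s : nat -> 'cV[R]_n) (alpha : nat -> R)
    (hf : self_concordant_like f M)
    (hg_proper : proper_fun g)
    (hg_lsc : lower_semicontinuous g)
    (hg_convex : ereal_convex g)
    (hH : forall k, posdef (hessian f (x k)))
    (hseq : prox_newton_seq f g x s alpha) :
  forall k : nat,
    let d := s k - x k in
    let lambda := local_norm f (x k) d in
    let r := M * norm2 d in
    d != 0 ->
    alpha k = r^-1 * ln (1 + r) ->
    (objective f g (x k.+1) <=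
       objective f g (x k)
       - (r^-1 * lambda ^+ 2 * ((1 + r^-1) * ln (1 + r) - 1))%:E)%E
    /\ (forall a : R,
          (worst_case n M lambda r (alpha k) <= worst_case n M lambda r a)%E).
Proof.
move=> k d lambda r d0 ak; have [M0 _ _ _] := hf.
have [_ /(_ k) [smin xS]] := hseq.
have r0 : 0 < r by rewrite mulr_gt0// norm2_gt0.
have l0 : 0 < lambda by rewrite sqrtr_gt0 hH.
split=> [|a].
  rewrite xS ak; have [gdom|] := boolP (g (x k) < +oo)%E.
    by apply: prox_newton_decrease => //; rewrite -subr_eq0.
  (* Earlier step-sizes are arbitrary, so [x k] may lie outside the domain of [g]; the right-hand
     side is then [+oo]. *)
  by rewrite -leNgt leye_eq /objective => /eqP ->; rewrite leey.
(* A nonzero coordinate of [d] supplies the axis for the extremal problem. *)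
have [i _] : exists i : 'I_n, d i 0 != 0.
  apply/existsP; apply: contraNT d0 => /existsPn d0.
  apply/eqP/matrixP => i j; rewrite ord1 [RHS]mxE; apply/eqP.
  by have := d0 i; rewrite negbK.
by rewrite ak; exact: worst_case_optimal.
Qed.
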